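(* Let $N\ge 1$ be an integer and $\sigma>0$. If $Q\in C([0,\infty))$ is such that $Q(r)\ge 0$ for all $r$ and $$\limsup_{r\to 0^+}\frac{Q(r)}{r^2}<\infty,$$ then there exists a unique solution $\phi\in C^1([0,\infty))$ to $$\phi'(r)=-r\,\phi(r)^2-\frac{N}{r}\phi(r)+\frac{Q(r)}{\sigma^4 r},\qquad r>0,$$ such that $\phi(0)=0$. *)

(* Defs.v *)
From HB Require Import structures.
From mathcomp Require Import all_boot all_order all_algebra.
From mathcomp Require Import all_classical all_reals all_analysis.

Set Implicit Arguments.
Unset Strict Implicit.
Unset Printing Implicit Defensive.

Import Order.TTheory GRing.Theory Num.Theory.
Import numFieldNormedType.Exports.

Local Open Scope classical_set_scope.
Local Open Scope ring_scope.

(* The increment y - x is restricted to y \in D, so that on `[0, +oo[ this is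
   the usual derivative at x > 0 and the right derivative at x = 0; the values
   of f outside D play no role when x \in D. *)
Definition derivative_within (R : realType) (D : set R) (f : R -> R)
    (x l : R) : Prop :=
  (f y - f x) / (y - x) @[y --> within D x^'] --> l.

Definition C1_on (R : realType) (D : set R) (f : R -> R) : Prop :=
  exists df : R -> R,
    (forall x, D x -> derivative_within D f x (df x)) /\
    {within D, continuous df}.

(* Functions on [0, +oo) are represented by total functions R -> R. *)
Definition riccati_solution (R : realType) (N : nat) (sigma : R) (Q : R -> R)
    (phi : R -> R) : Prop :=
  [/\ C1_on `[0, +oo[ phi,
      forall r : R, 0 < r ->
        derive1 phi r = - r * phi r ^+ 2 - N%:R / r * phi r
                    + Q r / (sigma ^+ 4 * r)
    & phi 0 = 0].

(* Main.v *)
Require Import Defs.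
From HB Require Import structures.
From mathcomp Require Import all_boot all_order all_algebra.
From mathcomp Require Import all_classical all_reals all_analysis.
From mathcomp Require Import ring lra.

(** The Riccati equation is linearized by the substitution phi = u' / (r
    u). With q = Q / sigma^4 it becomes the radial linear equation
    r^-(N-1) (r^(N-1) u')' = q u, with u(0) = 1 and u'(0) = 0, which in
    integral form reads u = 1 + V (q u), where V is the inverse of the
    radial Laplacian. The singularity at the origin disappears in this
    form, because the kernel of V is an average: |r^-N times the integral
    of t^(N-1) g over [0, r]| is at most the supremum of |g| on [0, r]
    ([radial_mean_norm]).

    Existence. In the weighted norm sup |f(t)| exp (- L t) on [0, T], the
    map v |-> V (q v) is a contraction once L is large
    ([volterra_contraction]), so Picard iteration gives u on the whole
    half-line ([volterra_fixpoint]). As q is nonnegative, u is at least 1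
    and phi = u' / (r u) is defined for all r > 0; this positivity is what
    rules out the blow-up that a Riccati equation could have. In terms of
    w(r) = r^-N times the integral of t^(N-1) q u over [0, r], phi = w /
    u, and the equation for phi is the quotient rule
    ([is_derive_riccati]).

    Regularity at the origin. The bound on the limsup gives q(r) <= C r^2
    near 0, hence phi = O(r^2), and then each of the three terms of the
    equation is O(r). So phi'(0) = 0 and phi' is continuous at 0
    ([C1_on_quadratic_origin]).

    Uniqueness. If phi and psi are solutions, W = r^N (psi - phi)
    satisfies W' = - r (psi + phi) W, where the singular terms have
    cancelled, and W(0) = 0; an energy estimate gives W = 0
    ([linear_ode_eq0], [riccati_unique]). *)

Set Implicit Arguments.
Unset Strict Implicit.
Unset Printing Implicit Defensive.

Import Order.TTheory GRing.Theory Num.Theory.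
Import numFieldNormedType.Exports.

Local Open Scope classical_set_scope.
Local Open Scope ring_scope.

(** * Continuity and differentiability on the real line *)

Lemma continuous_atP (R : realType) (f : R -> R) (x : R) :
  {for x, continuous f} <->
  forall e, 0 < e -> exists2 d, 0 < d &
    forall y, `|y - x| < d -> `|f y - f x| <= e.
Proof.
split=> [fx e e0|fx].
  have /cvgrPdist_le /(_ e e0) := fx.
  move=> /nbhs_ballP [d /= d0 dP]; exists d => // y yd.
  by rewrite distrC; apply: dP; rewrite /ball /= distrC.
apply/cvgrPdist_le => e e0; have [d d0 dP] := fx e e0.
apply/nbhs_ballP; exists d => //= y yd.
by rewrite distrC; apply: dP; rewrite distrC.
Qed.

Lemma is_derive_continuous (R : realType) (f : R -> R) (x df : R) :
  is_derive x 1 f df -> {for x, continuous f}.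
Proof.
by move=> [fx _]; apply: differentiable_continuous; apply/derivable1_diffP.
Qed.

Lemma is_derive_Xn (R : realType) (n : nat) (r : R) :
  is_derive r 1 (fun x : R => x ^+ n) (n%:R * r ^+ n.-1).
Proof.
have := is_deriveX n (is_derive_id r 1).
rewrite /GRing.scale /= mulr1.
by have -> : (id : R -> R) ^+ n = (fun x : R => x ^+ n) by exact: exprfctE.
Qed.

Lemma derive_le_increment (R : realType) (f g df dg : R -> R) (a b : R) :
  a <= b ->
  (forall x, a <= x <= b -> is_derive x 1 f (df x)) ->
  (forall x, a <= x <= b -> is_derive x 1 g (dg x)) ->
  (forall x, a <= x <= b -> df x <= dg x) ->
  f b - f a <= g b - g a.
Proof.
move=> ab fd gd dfg.
have hd x : a <= x <= b -> is_derive x 1 (fun y => g y - f y) (dg x - df x).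
  by move=> xab; apply: is_deriveB; [exact: gd|exact: fd].
have hd0 (x : R) : x \in `]a, b[ ->
    is_derive x 1 (fun y => g y - f y) (dg x - df x).
  by rewrite in_itv /= => /andP[/ltW ax /ltW xb]; apply: hd; rewrite ax.
have hc : {within `[a, b], continuous (fun y => g y - f y)}.
  apply: derivable_within_continuous => x.
  by rewrite in_itv /= => xab; have [] := hd x xab.
have [c] := MVT_segment ab hd0 hc; rewrite in_itv /= => cab h.
have : 0 <= (dg c - df c) * (b - a) by rewrite mulr_ge0 ?subr_ge0 ?dfg.
rewrite -h; lra.
Qed.

(** * Extension from the half-line by clamping *)

Lemma clamp_continuous (R : realType) : continuous (Num.max (0 : R)).
Proof.
move=> x; apply: (@continuous_max R R (fun=> 0) id x).
  exact: cst_continuous.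
exact: cvg_id.
Qed.

(** A function continuous on the half-line is traded for its extension by the
    constant f 0 to the left, so that everywhere-continuous functions can be
    used. *)
Lemma within_clamp_continuous (R : realType) (f : R -> R) :
  {within `[0, +oo[, continuous f} -> continuous (fun r : R => f (Num.max 0 r)).
Proof.
move=> fc x.
have Dx y : `[0, +oo[%classic (Num.max (0 : R) y).
  by rewrite /= in_itv /= andbT le_max lexx.
have : f y @[y --> within `[0, +oo[ (nbhs (Num.max 0 x))] --> f (Num.max 0 x).
  by have := fc (Num.max 0 x); rewrite /continuous_at nbhs_subspace_in.
move=> fD A /fD DA.
apply: (@filterS _ (nbhs x) _ _ _ _ (@clamp_continuous R x _ DA)) => y Dy.
exact: Dy (Dx y).
Qed.

Lemma continuous_within_clamp (R : realType) (f : R -> R) :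
  continuous (fun r : R => f (Num.max 0 r)) -> {within `[0, +oo[, continuous f}.
Proof.
move=> fc; have H : {in `[0, +oo[%classic, (fun r : R => f (Num.max 0 r)) =1 f}.
  move=> x /set_mem /=; rewrite in_itv /= andbT => x0.
  by rewrite (max_idPr x0).
exact: subspace_eq_continuous H (continuous_subspaceT fc).
Qed.

(** * Primitives of continuous functions *)

(** The base point -1 lies to the left of 0 so that 0 is interior to the
    domain of integration and the two-sided derivative exists at 0 as well. *)
Definition primitive (R : realType) (g : R -> R) (r : R) : R :=
  \int[lebesgue_measure]_(t in `[-1, r]) g t -
  \int[lebesgue_measure]_(t in `[-1, 0]) g t.

Lemma primitive0 (R : realType) (g : R -> R) : primitive g 0 = 0.
Proof. by rewrite /primitive subrr. Qed.

Lemma is_derive_primitive (R : realType) (g : R -> R) (r : R) :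
  continuous g -> 0 <= r -> is_derive r 1 (primitive g) (g r).
Proof.
move=> gc r0.
pose F := fun x : R => \int[lebesgue_measure]_(t in `[-1, x]) g t.
have [dF Fr] : derivable F r 1 /\ derive1 F r = g r.
  apply: (@continuous_FTC1_closed _ _ _ _ (r + 1)); last exact: gc.
  - by rewrite ltrDl.
  - apply: continuous_compact_integrable; first exact: segment_compact.
    exact: continuous_subspaceT.
  - by lra.
rewrite derive1E in Fr.
have H := DeriveDef dF Fr.
rewrite -[g r]subr0; apply: is_deriveB.
Qed.

Lemma primitive_clamp_continuous (R : realType) (g : R -> R) :
  continuous g -> continuous (fun r : R => primitive g (Num.max 0 r)).
Proof.
move=> gc x; apply: continuous_comp; first exact: clamp_continuous.
apply: is_derive_continuous; apply: is_derive_primitive => //.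
by rewrite le_max lexx.
Qed.

(** This intermediate point stands in for monotonicity and linearity of the
    integral when radial means are bounded. *)
Lemma primitiveB_mvt (R : realType) (f g : R -> R) (r : R) :
  continuous f -> continuous g -> 0 < r ->
  exists2 c, 0 < c < r &
    primitive f r - primitive g r = (f c - g c) * r.
Proof.
move=> fc gc r0.
have dD (x : R) : 0 <= x ->
    is_derive x 1 (fun y : R => primitive f y - primitive g y) (f x - g x).
  by move=> x0; apply: is_deriveB; apply: is_derive_primitive.
have dD0 (x : R) : x \in `]0, r[ ->
    is_derive x 1 (fun y : R => primitive f y - primitive g y) (f x - g x).
  by rewrite in_itv /= => /andP[/ltW x0 _]; exact: dD.
have cD : {within `[0, r], continuous (fun y => primitive f y - primitive g y)}.
  apply: derivable_within_continuous => x.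
  by rewrite in_itv /= => /andP[x0 _]; have [] := dD x x0.
have [c cr] := MVT r0 dD0 cD.
by rewrite !primitive0 !subr0 => ->; exists c.
Qed.

Lemma primitive_mvt (R : realType) (f : R -> R) (r : R) :
  continuous f -> 0 < r ->
  exists2 c, 0 < c < r & primitive f r = f c * r.
Proof.
move=> fc r0.
have zc : continuous (fun _ : R => 0 : R) by move=> x; exact: cvg_cst.
have [c cr] := primitiveB_mvt fc zc r0.
have -> : primitive (fun=> 0 : R) r = 0.
  by rewrite /primitive !Rintegral_cst// !mul0r subrr.
by rewrite !subr0 => ->; exists c.
Qed.

(** * Weighted radial means *)

Lemma continuous_Xn_mul (R : realType) (n : nat) (g : R -> R) :
  continuous g -> continuous (fun t : R => t ^+ n * g t).
Proof.
move=> gc x; apply: (@continuousM R R (fun t : R => t ^+ n) g x).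
  exact: exprn_continuous.
exact: gc.
Qed.

(** This is r^-(n+1) times the integral of t^n g(t) over [0, r], that is,
    1/(n+1) times the average of the radial function g over the ball of radius
    r in dimension n+1. Since 0^-1 = 0, its value at 0 is 0 and not the limit
    g(0)/(n+1). *)
Definition radial_mean (R : realType) (n : nat) (g : R -> R) (r : R) : R :=
  primitive (fun t => t ^+ n * g t) r / r ^+ n.+1.

(** The mean value theorem produces c^n (f c - g c) r / r^(n+1) with c < r,
    and (c / r)^n is at most 1: the singular weight is harmless. *)
Lemma radial_mean_dist (R : realType) (n : nat) (f g : R -> R) (r B : R) :
  continuous f -> continuous g -> 0 < r ->
  (forall t, 0 < t < r -> `|f t - g t| <= B) ->
  `|radial_mean n f r - radial_mean n g r| <= B.
Proof.
move=> fc gc r0 fgB; rewrite /radial_mean -mulrBl.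
have [c /[dup] cr /andP[c0 /ltW cler] ->] :=
  primitiveB_mvt (continuous_Xn_mul (n := n) fc)
                 (continuous_Xn_mul (n := n) gc) r0.
rewrite -mulrBr exprS invfM mulrA mulfK ?gt_eqF// mulrAC -expr_div_n normrM.
have cn : `|(c / r) ^+ n| <= 1.
  have cr0 : 0 <= c / r by rewrite divr_ge0 ?ltW.
  rewrite ger0_norm ?exprn_ge0// exprn_ile1// ler_pdivrMr// mul1r.
  exact: cler.
by rewrite -[leRHS]mul1r ler_pM // fgB.
Qed.

Lemma radial_mean_norm (R : realType) (n : nat) (g : R -> R) (r B : R) :
  continuous g -> 0 < r -> (forall t, 0 < t < r -> `|g t| <= B) ->
  `|radial_mean n g r| <= B.
Proof.
move=> gc r0 gB.
have zc : continuous (fun _ : R => 0 : R) by move=> x; exact: cvg_cst.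
have z0 : radial_mean n (fun _ : R => 0 : R) r = 0.
  rewrite /radial_mean.
  have [c _ ->] := primitive_mvt (continuous_Xn_mul (n := n) zc) r0.
  by rewrite mulr0 !mul0r.
rewrite -[X in `|X|]subr0 -z0; apply: radial_mean_dist => // t tr.
by rewrite subr0 gB.
Qed.

Lemma radial_mean_ge0 (R : realType) (n : nat) (g : R -> R) (r : R) :
  continuous g -> 0 < r -> (forall t, 0 <= g t) -> 0 <= radial_mean n g r.
Proof.
move=> gc r0 g0; rewrite /radial_mean.
have [c /andP[/ltW c0 _] ->] :=
  primitive_mvt (continuous_Xn_mul (n := n) gc) r0.
by rewrite divr_ge0 ?exprn_ge0 ?mulr_ge0 ?exprn_ge0 ?g0 // ltW.
Qed.

(** This identity produces the singular term of the Riccati equation. *)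
Lemma is_derive_radial_mean (R : realType) (n : nat) (g : R -> R) (r : R) :
  continuous g -> 0 < r ->
  is_derive r 1 (radial_mean n g)
    (g r / r - n.+1%:R / r * radial_mean n g r).
Proof.
move=> gc r0.
have dP := is_derive_primitive (continuous_Xn_mul (n := n) gc) (ltW r0).
have rn0 : r ^+ n.+1 != 0 by rewrite expf_neq0 // gt_eqF.
have dX := is_derive_Xn n.+1 r.
have dV := @is_deriveV _ (fun x : R => x ^+ n.+1) _ _ _ rn0 dX.
have dPV : is_derive r 1 (radial_mean n g) _ := is_deriveM dP dV.
apply: is_derive_eq.
rewrite /radial_mean /GRing.scale /= !exprS.
have ? : r != 0 by rewrite gt_eqF.
have ? : r ^+ n != 0 by rewrite expf_neq0.
by field; apply/andP.
Qed.

(** * The Volterra operator inverting the radial Laplacian *)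

(** Radial derivative of the solution of Laplacian v = g in dimension n+1; the
    clamp extends it by 0 to negative radii. *)
Definition radial_flux (R : realType) (n : nat) (g : R -> R) (r : R) : R :=
  Num.max 0 r * radial_mean n g (Num.max 0 r).

Lemma radial_fluxE (R : realType) (n : nat) (g : R -> R) (r : R) :
  0 <= r -> radial_flux n g r = r * radial_mean n g r.
Proof. by move=> r0; rewrite /radial_flux (max_idPr r0). Qed.

(** At 0 the factor r tends to 0 while the radial mean stays bounded, although
    the latter may jump there. *)
Lemma radial_flux_continuous (R : realType) (n : nat) (g : R -> R) :
  continuous g -> continuous (radial_flux n g).
Proof.
move=> gc x; have [x0|x0] := ltP 0 x.
  have mx : Num.max 0 x = x by apply/max_idPr/ltW.
  apply: (@continuousM R R (Num.max 0)
            (fun r => radial_mean n g (Num.max 0 r)) x).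
    exact: clamp_continuous.
  apply: (@continuous_comp _ _ _ (Num.max (0 : R)) (radial_mean n g) x).
    exact: clamp_continuous.
  rewrite mx; exact: is_derive_continuous (is_derive_radial_mean n gc x0).
have [d d0 dP] := (continuous_atP g 0).1 (gc 0) 1 ltr01.
pose B := `|g 0| + 1.
have B0 : 0 < B by rewrite ltr_wpDl.
apply/continuous_atP => e e0.
exists (Num.min d (e / B)); first by rewrite lt_min d0 divr_gt0.
move=> y; rewrite lt_min => /andP[yd ye].
rewrite {2}/radial_flux (max_idPl x0) mul0r subr0.
have [y0|y0] := leP y 0.
  by rewrite /radial_flux (max_idPl y0) mul0r normr0 ltW.
have yx : y <= `|y - x| by rewrite (le_trans _ (ler_norm _))// lerBrDr gerDl.
rewrite radial_fluxE ?(ltW y0)// normrM gtr0_norm//.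
have mB : `|radial_mean n g y| <= B.
  apply: radial_mean_norm => // t /andP[t0 ty].
  have : `|g t - g 0| <= 1.
    apply: dP; rewrite subr0 gtr0_norm//.
    exact: lt_trans ty (le_lt_trans yx yd).
  rewrite /B => gt1; rewrite -[g t](subrK (g 0)) addrC.
  by rewrite (le_trans (ler_normD _ _))// lerD2l.
apply: (@le_trans _ _ (e / B * B)); last by rewrite divfK ?gt_eqF.
by apply: ler_pM => //; [exact: ltW|exact: le_trans yx (ltW ye)].
Qed.

(** Inverse of the radial Laplacian r^-n (r^n v')' with v(0) = v'(0) = 0. *)
Definition volterra (R : realType) (n : nat) (g : R -> R) (r : R) : R :=
  primitive (radial_flux n g) (Num.max 0 r).

Lemma volterra_continuous (R : realType) (n : nat) (g : R -> R) :
  continuous g -> continuous (volterra n g).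
Proof.
by move=> gc; apply: primitive_clamp_continuous; exact: radial_flux_continuous.
Qed.

Lemma volterra_ge0 (R : realType) (n : nat) (g : R -> R) (r : R) :
  continuous g -> (forall t, 0 <= g t) -> 0 <= volterra n g r.
Proof.
move=> gc g0; rewrite /volterra; have [r0|r0] := leP r 0.
  by rewrite primitive0.
have [c /andP[c0 _] ->] :=
  primitive_mvt (radial_flux_continuous (n := n) gc) r0.
rewrite mulr_ge0 ?(ltW r0)// radial_fluxE ?(ltW c0)// mulr_ge0 ?(ltW c0)//.
by apply: radial_mean_ge0.
Qed.

Lemma is_derive_volterra (R : realType) (n : nat) (g : R -> R) (r : R) :
  continuous g -> 0 < r ->
  is_derive r 1 (volterra n g) (r * radial_mean n g r).
Proof.
move=> gc r0; rewrite -radial_fluxE ?ltW//.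
apply: (@near_eq_is_derive _ _ _ (primitive (radial_flux n g))).
  near=> y; rewrite /volterra.
  have y0 : 0 < y by near: y; exact: lt_nbhsr.
  by rewrite (max_idPr (ltW y0)).
by apply: is_derive_primitive (ltW r0); exact: radial_flux_continuous.
Unshelve. all: by end_near.
Qed.

(** The weight exp (L t) turns one integration into a gain of a factor 1 / L,
    which makes the operator contracting on intervals of any length. *)
Lemma volterra_dist (R : realType) (n : nat) (f g : R -> R) (T L B r : R) :
  continuous f -> continuous g -> 0 < L -> 0 <= B ->
  (forall t, 0 <= t <= T -> `|f t - g t| <= B * expR (L * t)) ->
  0 <= r <= T ->
  `|volterra n f r - volterra n g r| <= T / L * B * expR (L * r).
Proof.
move=> fc gc L0 B0 fgB /andP[r0 rT].
have T0 : 0 <= T := le_trans r0 rT.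
have dE (x : R) :
    is_derive x 1 (fun y => T / L * B * expR (L * y)) (T * B * expR (L * x)).
  have dL : is_derive x 1 (fun y : R => L * y) L.
    by apply: is_derive_eq; rewrite /GRing.scale /= mulr1.
  have dEL := is_derive1_comp (is_derive_expR (L * x)) dL.
  have H : is_derive x 1 (fun y => T / L * B * expR (L * y)) _ :=
    is_deriveZ (T / L * B) dEL.
  apply: is_derive_eq; rewrite /GRing.scale /=.
  have ? : L != 0 by rewrite gt_eqF.
  by field.
have fluxB (x : R) : 0 <= x <= r ->
    `|radial_flux n f x - radial_flux n g x| <= T * B * expR (L * x).
  move=> /andP[x0 xr]; rewrite !radial_fluxE// -mulrBr normrM ger0_norm//.
  move: x0; rewrite le_eqVlt => /predU1P[<-|x0].
    by rewrite mul0r !mulr_ge0 ?expR_ge0.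
  rewrite -mulrA; apply: ler_pM => //; first exact: ltW.
    exact: le_trans xr rT.
  apply: radial_mean_dist => // t /andP[t0 tx].
  apply: le_trans (fgB _ _) _.
    by rewrite (ltW t0)/= (le_trans (ltW tx))// (le_trans xr).
  by rewrite ler_wpM2l// ler_expR ler_pM2l// ltW.
have dB (h k : R -> R) (x : R) : continuous h -> continuous k -> 0 <= x ->
    is_derive x 1 (fun y => primitive (radial_flux n h) y
                            - primitive (radial_flux n k) y)
      (radial_flux n h x - radial_flux n k x).
  move=> hc kc x0.
  by apply: is_deriveB; apply: is_derive_primitive => //;
     exact: radial_flux_continuous.
rewrite /volterra (max_idPr r0).
have E0 : 0 <= T / L * B by rewrite mulr_ge0 ?divr_ge0// ltW.
have half (h k : R -> R) : continuous h -> continuous k ->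
   (forall x, 0 <= x <= r ->
    `|radial_flux n h x - radial_flux n k x| <= T * B * expR (L * x)) ->
   primitive (radial_flux n h) r - primitive (radial_flux n k) r
     <= T / L * B * expR (L * r).
  move=> hc kc hk.
  have := @derive_le_increment R _ _ _ _ 0 r r0
    (fun x xr => dB h k x hc kc (andP xr).1) (fun x _ => dE x)
    (fun x xr => le_trans (ler_norm _) (hk x xr)).
  rewrite !primitive0 subrr subr0 mulr0 expR0 mulr1 => /le_trans; apply.
  by rewrite lerBlDr lerDl.
rewrite ler_norml; apply/andP; split; last exact: half.
rewrite lerNl opprB; apply: half => // x xr.
by rewrite distrC; exact: fluxB.
Qed.

(** The factor 1/2 holds on every bounded interval for the weight exp (L t),
    with L depending on the interval; this gives a global solution without
    continuation arguments. *)
Lemma volterra_contraction (R : realType) (n : nat) (q : R -> R) (T : R) :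
  continuous q -> 0 <= T ->
  exists2 L, 0 < L & forall (f g : R -> R) (B r : R),
    continuous f -> continuous g -> 0 <= B ->
    (forall t, 0 <= t <= T -> `|f t - g t| <= B * expR (L * t)) ->
    0 <= r <= T ->
    `|volterra n (fun t => q t * f t) r - volterra n (fun t => q t * g t) r|
      <= B / 2 * expR (L * r).
Proof.
move=> qc T0.
have [M M0 MP] : exists2 M, 0 < M & forall t, 0 <= t <= T -> `|q t| <= M.
  have qn : {within `[0, T], continuous (fun t => `|q t|)}.
    apply: continuous_subspaceT => x.
    by apply: continuous_comp; [exact: qc|exact: norm_continuous].
  have [c _ cM] := EVT_max T0 qn.
  exists (`|q c| + 1) => [|t tT]; first by rewrite ltr_wpDl.
  by rewrite (le_trans (cM t _)) ?in_itv// lerDl.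
have L0 : 0 < 2 * T * M + 1 by rewrite ltr_wpDl// !mulr_ge0// ltW.
(* L is chosen so that the factor T * M / L is at most 1/2; the + 1 keeps L
   positive when T = 0. *)
exists (2 * T * M + 1) => // f g B r fc gc B0 fgB rT.
have mc h : continuous h -> continuous (fun t => q t * h t).
  by move=> hc x; apply: (@continuousM R R q h x); [exact: qc|exact: hc].
have := @volterra_dist R n _ _ T _ (M * B) r (mc _ fc) (mc _ gc) L0.
have MB0 : 0 <= M * B by rewrite mulr_ge0// ltW.
have qfgB t : 0 <= t <= T ->
    `|q t * f t - q t * g t| <= M * B * expR ((2 * T * M + 1) * t).
  by move=> tT; rewrite -mulrBr normrM -mulrA ler_pM// ?MP ?fgB.
move=> /(_ MB0 qfgB rT) /le_trans; apply.
rewrite ler_wpM2r ?expR_ge0//.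
rewrite mulrAC ler_pdivrMr// -subr_ge0.
have -> : B / 2 * (2 * T * M + 1) - T * (M * B) = B / 2 by field.
by rewrite divr_ge0.
Qed.

(** * Global solution of the linear equation *)

Lemma half_pow_small (R : realType) (K e : R) :
  0 < e -> exists k0, forall k, (k0 <= k)%N -> K / 2 ^+ k <= e.
Proof.
move=> e0; have [k kP] : exists k : nat, `|K / e| <= k%:R.
  by exists (Num.bound `|K / e|); apply: ltW; exact: archi_boundP.
exists k => j kj; have p0 : (0 : R) < 2 ^+ j by rewrite exprn_gt0.
rewrite ler_pdivrMr// -ler_pdivrMl// mulrC.
apply: le_trans (ler_norm _) (le_trans kP _).
by rewrite -natrX ler_nat (leq_trans kj)// ltnW// ltn_expl.
Qed.

(** The constant C is not part of the definition of the limit, so one sequence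
    may be estimated with several constants; the iterates below need this
    because their bounds depend on the interval. *)
Lemma geometric_limit (R : realType) (a : R^nat) (C : R) :
  (forall k, `|a k.+1 - a k| <= C / 2 ^+ k) ->
  forall k, `|limn a - a k| <= 2 * C / 2 ^+ k.
Proof.
move=> aC.
have C0 : 0 <= C.
  by have := le_trans (normr_ge0 _) (aC 0%N); rewrite expr0 divr1.
have w0 k : 0 <= C / 2 ^+ k by rewrite divr_ge0 ?exprn_ge0.
have wS k : 2 * C / 2 ^+ k.+1 = C / 2 ^+ k.
  rewrite exprS; have ? : (2 : R) ^+ k != 0 by rewrite expf_neq0.
  by field.
have tail k j : `|a (k + j)%N - a k| <= 2 * C / 2 ^+ k - 2 * C / 2 ^+ (k + j).
  elim: j => [|j IH]; first by rewrite addn0 !subrr normr0.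
  have -> : a (k + j.+1)%N - a k =
      (a (k + j).+1 - a (k + j)%N) + (a (k + j)%N - a k).
    by rewrite addnS addrA subrK.
  apply: le_trans (ler_normD _ _) _.
  apply: le_trans (lerD (aC (k + j)%N) IH) _.
  by rewrite addnS wS -[2 * C / 2 ^+ (k + j)]mulrA; lra.
have tail' k m : (k <= m)%N -> `|a m - a k| <= 2 * C / 2 ^+ k.
  move=> km; rewrite -(subnKC km); apply: le_trans (tail _ _) _.
  by rewrite gerBl !mulr_ge0 ?invr_ge0 ?exprn_ge0.
have ac : cvgn a.
  apply/cauchy_cvgP/cauchy_exP => e e0.
  have [k kP] := half_pow_small (2 * C) (divr_gt0 e0 (ltr0Sn R 1)).
  exists (a k); exists k => // m /= km; rewrite /ball /= distrC.
  apply: le_lt_trans (tail' k m km) (le_lt_trans (kP k (leqnn k)) _).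
  by rewrite ltr_pdivrMr// mulr2n mulrDr mulr1 ltrDl.
move=> k; apply/ler_addgt0Pr => e e0.
have /cvgrPdist_le /(_ e e0) [j _ jP] := ac.
have jm : (j <= maxn j k)%N by rewrite leq_maxl.
have -> : limn a - a k =
    (limn a - a (maxn j k)) + (a (maxn j k) - a k) by rewrite addrA subrK.
apply: le_trans (ler_normD _ _) _; rewrite addrC; apply: lerD.
  by apply: tail'; rewrite leq_maxr.
exact: jP jm.
Qed.

(** Picard iteration from the constant 1, convergent uniformly on bounded sets
    by the contraction property. Nonnegativity of q keeps all iterates at
    least 1, so that the limit never vanishes and may be used as a
    denominator. *)
Lemma volterra_fixpoint (R : realType) (n : nat) (q : R -> R) :
  continuous q -> (forall t, 0 <= q t) ->
  exists2 u : R -> R, continuous u & forall r,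
    1 <= u r /\ u r = 1 + volterra n (fun t => q t * u t) r.
Proof.
move=> qc q0.
pose Phi (v : R -> R) r := 1 + volterra n (fun t => q t * v t) r.
pose pic := fix pic k := if k is k'.+1 then Phi (pic k') else fun=> 1.
have mc h : continuous h -> continuous (fun t => q t * h t).
  by move=> hc x; apply: (@continuousM R R q h x); [exact: qc|exact: hc].
have Phic v : continuous v -> continuous (Phi v).
  move=> vc x; rewrite /continuous_at /Phi; apply: cvgD; first exact: cvg_cst.
  exact: volterra_continuous (mc _ vc) x.
have picc k : continuous (pic k).
  by elim: k => [|k IH] /=; [move=> x; exact: cvg_cst|exact: Phic].
have pic1 k r : 1 <= pic k r.
  elim: k r => [//|k IH] r /=; rewrite /Phi lerDl volterra_ge0// => [|t].
    exact: mc.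
  by rewrite mulr_ge0// (le_trans ler01).
have maxK r : Num.max 0 (Num.max 0 r) = Num.max 0 r :> R.
  by apply/max_idPr; rewrite le_max lexx.
have Phi_max v r : Phi v r = Phi v (Num.max 0 r) by rewrite /Phi /volterra maxK.
have pic_max k r : pic k r = pic k (Num.max 0 r).
  by case: k => [//|k]; exact: Phi_max.
pose u r := limn (fun k => pic k r).
have u_max r : u r = u (Num.max 0 r).
  rewrite /u; have -> // : (fun k => pic k r) = (fun k => pic k (Num.max 0 r)).
  by apply/funext => k; exact: pic_max.
(* [0, T] is fixed here because the contraction weight L depends on T. *)
have picB T : 0 <= T -> exists L, exists C, [/\ 0 < L, 0 <= C &
    forall k r, 0 <= r <= T ->
      `|pic k.+1 r - pic k r| <= C / 2 ^+ k * expR (L * r)].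
  move=> T0; have [L L0 Lq] := @volterra_contraction R n q T qc T0.
  have qn : {within `[0, T], continuous (fun t => `|pic 1%N t - pic 0%N t|)}.
    apply: continuous_subspaceT => x.
    by apply: cvg_norm; apply: cvgB; exact: picc.
  have [c _ cM] := EVT_max T0 qn.
  set C := `|_ - _| in cM; have C0 : 0 <= C by exact: normr_ge0.
  exists L; exists C; split=> //; elim=> [|k IH] r rT.
    rewrite expr0 divr1; apply: le_trans (cM r _) _; first by rewrite in_itv.
    rewrite ler_peMr// -expR0 ler_expR mulr_ge0// ?(ltW L0)//.
    by case/andP: rT.
  have -> : pic k.+2 r - pic k.+1 r = volterra n (fun t => q t * pic k.+1 t) r
      - volterra n (fun t => q t * pic k t) r.
    by rewrite /= /Phi opprD addrACA subrr add0r.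
  apply: le_trans (Lq _ _ (C / 2 ^+ k) r _ _ _ _ rT) _; try exact: picc.
  - by rewrite divr_ge0// exprn_ge0.
  - by move=> t tT; exact: IH.
  - by rewrite exprSr invfM mulrA.
have uB T : 0 <= T -> exists L, exists C, [/\ 0 < L, 0 <= C &
    forall k r, 0 <= r <= T ->
      `|u r - pic k r| <= C / 2 ^+ k * expR (L * r)].
  move=> T0; have [L [C [L0 C0 LC]]] := picB T T0.
  exists L; exists (2 * C); split; rewrite ?mulr_ge0// => k r rT.
  rewrite mulrAC -(mulrA 2 C).
  apply: (@geometric_limit R (fun k => pic k r)) => j.
  by apply: le_trans (LC j r rT) _; rewrite mulrAC.
have small T e : 0 <= T -> 0 < e ->
    exists k0, forall k r, (k0 <= k)%N -> r <= T -> `|u r - pic k r| <= e.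
  move=> T0 e0; have [L [C [L0 C0 LC]]] := uB T T0.
  have [k kP] := half_pow_small (C * expR (L * T)) e0.
  exists k => j r kj rT; rewrite u_max pic_max.
  have rT' : 0 <= Num.max 0 r <= T by rewrite le_max lexx ge_max T0.
  apply: le_trans (LC j _ rT') (le_trans _ (kP j kj)).
  rewrite mulrAC ler_wpM2r ?invr_ge0 ?exprn_ge0// ler_wpM2l// ler_expR.
  by rewrite ler_pM2l//; case/andP: rT'.
have uc : continuous u.
  move=> x; apply/continuous_atP => e e0.
  have e3 : 0 < e / 3 by rewrite divr_gt0.
  have [k kP] := small (`|x| + 1) _ (addr_ge0 (normr_ge0 x) ler01) e3.
  have [d d0 dP] := (continuous_atP (pic k) x).1 (picc k x) _ e3.
  exists (Num.min d 1); first by rewrite lt_min d0 ltr01.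
  move=> y; rewrite lt_min => /andP[yd y1].
  have xT : x <= `|x| + 1 by rewrite (le_trans (ler_norm x))// lerDl.
  have yT : y <= `|x| + 1.
    rewrite -[y](subrK x) addrC lerD ?ler_norm//.
    exact: le_trans (ler_norm _) (ltW y1).
  have -> : u y - u x = (u y - pic k y) + (pic k y - pic k x) - (u x - pic k x).
    by ring.
  apply: le_trans (ler_normB _ _) _.
  apply: le_trans (lerD (ler_normD _ _) (lexx _)) _.
  have := kP k y (leqnn k) yT; have := kP k x (leqnn k) xT.
  by have := dP y yd; lra.
have u1 r : 1 <= u r.
  apply/ler_addgt0Pr => e e0.
  have m0 : 0 <= Num.max 0 r by rewrite le_max lexx.
  have [k kP] := small (Num.max 0 r) e m0 e0.
  have : `|u r - pic k r| <= e by apply: kP; rewrite ?le_max ?lexx ?orbT.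
  by have := pic1 k r; rewrite ler_norml => ? /andP[? _]; lra.
(* The defect u - Phi u at s is compared with Picard iterate k + 1 = Phi of
   iterate k: both terms are small by uniform convergence, the second one after
   contraction, which costs the factor E = exp (L s). *)
exists u => // r; split; first exact: u1.
rewrite -/(Phi u r) u_max Phi_max; set s := Num.max 0 r.
have s0 : 0 <= s by rewrite le_max lexx.
have [L L0 Lq] := @volterra_contraction R n q s qc s0.
apply/eqP; rewrite -subr_eq0 -normr_le0; apply/ler_addgt0Pr => e e0.
rewrite add0r.
pose E := expR (L * s); have E0 : 0 < E by exact: expR_gt0.
pose e' := e / (1 + E).
have e'0 : 0 < e' by rewrite divr_gt0// addr_gt0.
have [k kP] := small s e' s0 e'0.
have s0s : 0 <= s <= s by rewrite s0 lexx.
have PhiB : `|Phi u s - pic k.+1 s| <= e' / 2 * E.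
  have -> : Phi u s - pic k.+1 s = volterra n (fun t => q t * u t) s
      - volterra n (fun t => q t * pic k t) s.
    by rewrite /= /Phi opprD addrACA subrr add0r.
  apply: (Lq _ _ e' s) => //; first exact: ltW.
  move=> t /andP[t0 ts]; apply: le_trans (kP k t (leqnn k) ts) _.
  by rewrite ler_peMr ?(ltW e'0)// -expR0 ler_expR mulr_ge0// ltW.
have uS := kP k.+1 s (leqnSn k) (lexx s).
have -> : u s - Phi u s = (u s - pic k.+1 s) - (Phi u s - pic k.+1 s) by ring.
apply: le_trans (ler_normB _ _) (le_trans (lerD uS PhiB) _).
have -> : e = e' + e' * E.
  have ? : 1 + E != 0 by rewrite gt_eqF// addr_gt0.
  by rewrite /e'; field.
rewrite lerD2l ler_wpM2r ?(ltW E0)// ler_pdivrMr// ler_peMr ?(ltW e'0)//.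
by rewrite ler1n.
Qed.

(** * One-sided derivatives on the half-line *)

Lemma derivative_withinP (R : realType) (D : set R) (f : R -> R) (x l : R) :
  derivative_within D f x l <->
  forall e, 0 < e -> exists2 d, 0 < d & forall y, D y -> y != x ->
    `|y - x| < d -> `|(f y - f x) / (y - x) - l| <= e.
Proof.
split=> [fl e e0|fl].
  have /cvgrPdist_le /(_ e e0) := fl.
  move=> /nbhs_ballP [d /= d0 dP]; exists d => // y Dy yx yd.
  by rewrite distrC; apply: dP => //; rewrite /ball /= distrC.
apply/cvgrPdist_le => e e0; have [d d0 dP] := fl e e0.
apply/nbhs_ballP; exists d => //= y yd yx Dy.
by rewrite distrC; apply: dP => //; rewrite distrC.
Qed.

Lemma is_derive_dist (R : realType) (f : R -> R) (x l : R) :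
  is_derive x 1 f l <->
  forall e, 0 < e -> exists2 d, 0 < d & forall y, y != x ->
    `|y - x| < d -> `|(f y - f x) / (y - x) - l| <= e.
Proof.
split=> [[fx <-] e e0|fl].
  have /cvgrPdist_le /(_ e e0) := fx.
  move=> /nbhs_ballP [d /= d0 dP]; exists d => // y yx yd.
  have := dP (y - x).
  rewrite /ball /= sub0r normrN => /(_ yd); rewrite subr_eq0 => /(_ yx).
  by rewrite /GRing.scale /= mulr1 subrK distrC mulrC.
have H : h^-1 *: ((f \o shift x) (h *: 1) - f x) @[h --> 0^'] --> l.
  apply/cvgrPdist_le => e e0; have [d d0 dP] := fl e e0.
  apply/nbhs_ballP; exists d => //= h; rewrite /ball /= sub0r normrN => hd h0.
  have := dP (h + x); rewrite addrK -subr_eq0 addrK => /(_ h0 hd).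
  by rewrite /GRing.scale /= mulr1 distrC mulrC.
apply: DeriveDef; first by apply/cvg_ex; exists l.
exact: cvg_lim.
Qed.

Lemma derivative_within_interior (R : realType) (f : R -> R) (x l : R) :
  0 < x -> derivative_within `[0, +oo[ f x l <-> is_derive x 1 f l.
Proof.
move=> x0; split=> [/derivative_withinP fl|/is_derive_dist fl].
  apply/is_derive_dist => e /fl [d d0 dP].
  exists (Num.min d x); first by rewrite lt_min d0.
  move=> y yx; rewrite lt_min => /andP[yd]; rewrite ltr_norml => /andP[yx' _].
  apply: dP => //=; rewrite in_itv /= andbT ltW//.
  by rewrite ltrBrDr addNr in yx'.
by apply/derivative_withinP => e /fl [d d0 dP]; exists d => // y _; exact: dP.
Qed.

(** Clamping does not increase distances, so the bound on difference quotients
    within the half-line passes to the extended function, also at 0. *)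
Lemma C1_on_clamp_continuous (R : realType) (f : R -> R) :
  C1_on `[0, +oo[ f -> continuous (fun r : R => f (Num.max 0 r)).
Proof.
move=> [df [fd _]] x; apply/continuous_atP => e e0.
have Dm (y : R) : `[0, +oo[%classic (Num.max 0 y).
  by rewrite /= in_itv /= andbT le_max lexx.
have /derivative_withinP /(_ 1 ltr01) [d d0 dP] := fd _ (Dm x).
pose K := `|df (Num.max 0 x)| + 1.
have K0 : 0 < K by rewrite ltr_wpDl.
exists (Num.min d (e / K)); first by rewrite lt_min d0 divr_gt0.
move=> y; rewrite lt_min => /andP[yd ye].
have mxy : `|Num.max 0 y - Num.max 0 x| <= `|y - x|.
  have := ler_norm (y - x); have := ler_norm (x - y); rewrite (distrC x y).
  move=> xy yx; rewrite /Num.max ler_norml.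
  by case: ltP => ?; case: ltP => ?; apply/andP; split; lra.
have [->|mne] := eqVneq (Num.max 0 y) (Num.max 0 x).
  by rewrite subrr normr0 ltW.
have mne0 : Num.max 0 y - Num.max 0 x != 0 by rewrite subr_eq0.
have qK := dP _ (Dm y) mne (le_lt_trans mxy yd).
rewrite -[X in `|X|](divfK mne0) normrM.
apply: (@le_trans _ _ (K * (e / K))); last by rewrite mulrC divfK ?gt_eqF.
apply: ler_pM => //; last exact: le_trans mxy (ltW ye).
rewrite -[X in `|X|](subrK (df (Num.max 0 x))) addrC.
by apply: le_trans (ler_normD _ _) _; rewrite lerD2l.
Qed.

(** A quadratic bound forces a zero derivative at the origin, and the linear
    bound on df makes the derivative continuous there; away from 0 both facts
    are interior ones. *)
Lemma C1_on_quadratic_origin (R : realType) (f df : R -> R) (C d : R) :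
  0 < d -> f 0 = 0 -> df 0 = 0 ->
  (forall r : R, 0 < r -> is_derive r 1 f (df r)) ->
  (forall r : R, 0 < r ->
    {for r, continuous (fun s : R => df (Num.max 0 s))}) ->
  (forall r, 0 < r < d -> `|f r| <= C * r ^+ 2) ->
  (forall r, 0 < r < d -> `|df r| <= C * r) ->
  C1_on `[0, +oo[ f.
Proof.
move=> d0 f0 df0 fd dfc fC dfC; exists df; split.
  move=> x; rewrite /= in_itv /= andbT le_eqVlt => /predU1P[<-|x0]; last first.
    by apply/derivative_within_interior => //; exact: fd.
  apply/derivative_withinP => e e0.
  have K0 : 0 < `|C| + 1 by rewrite ltr_wpDl.
  exists (Num.min d (e / (`|C| + 1))); first by rewrite lt_min d0 divr_gt0.
  move=> y; rewrite /= in_itv /= andbT => y0 yn0.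
  have {y0 yn0}y0 : 0 < y by rewrite lt_neqAle eq_sym yn0.
  rewrite lt_min !subr0 f0 df0 !subr0 gtr0_norm// => /andP[yd ye].
  rewrite normrM normfV (gtr0_norm y0) ler_pdivrMr//.
  apply: le_trans (fC y _) _; first by rewrite y0.
  rewrite expr2 mulrA ler_wpM2r ?(ltW y0)//.
  apply: (@le_trans _ _ ((`|C| + 1) * y)).
    by rewrite ler_wpM2r ?(ltW y0)// (le_trans (ler_norm _))// lerDl.
  by rewrite mulrC -ler_pdivlMr// ltW.
apply: continuous_within_clamp => x; have [x0|x0] := ltP 0 x; first exact: dfc.
apply/continuous_atP => e e0.
have K0 : 0 < `|C| + 1 by rewrite ltr_wpDl.
exists (Num.min d (e / (`|C| + 1))); first by rewrite lt_min d0 divr_gt0.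
move=> y; rewrite lt_min => /andP[yd ye].
rewrite (max_idPl x0) df0 subr0.
have [y0|y0] := leP y 0; first by rewrite df0 normr0 ltW.
have yx : y <= `|y - x| by rewrite (le_trans _ (ler_norm _))// lerBrDr gerDl.
apply: le_trans (dfC y _) _; first by rewrite y0/= (le_lt_trans yx).
apply: (@le_trans _ _ ((`|C| + 1) * y)).
  by rewrite ler_wpM2r ?(ltW y0)// (le_trans (ler_norm _))// lerDl.
by rewrite mulrC -ler_pdivlMr// (le_trans yx)// ltW.
Qed.

(** * Uniqueness *)

(** The energy W^2 exp (-2 K x) is nonnegative, nonincreasing on ]0, r[, and
    tends to 0 at 0 by continuity of W, even if the equation is singular
    there. *)
Lemma linear_ode_eq0 (R : realType) (W a : R -> R) (K r : R) :
  0 < r -> continuous W -> W 0 = 0 ->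
  (forall x : R, 0 < x < r -> is_derive x 1 W (a x * W x)) ->
  (forall x, 0 < x < r -> a x <= K) ->
  W r = 0.
Proof.
move=> r0 Wc W0 Wd aK.
pose E x := W x ^+ 2 * expR (- (2 * K) * x).
have dexp (x : R) :
  is_derive x 1 (fun y : R => expR (- (2 * K) * y))
    (expR (- (2 * K) * x) * - (2 * K)).
  have dL : is_derive x 1 (fun y : R => - (2 * K) * y) (- (2 * K)).
    by apply: is_derive_eq; rewrite /GRing.scale /= mulr1.
  exact: (is_derive1_comp (is_derive_expR (- (2 * K) * x)) dL).
have Ed (x : R) : x \in `]0, r[ ->
    is_derive x 1 E (2 * (a x - K) * E x).
  rewrite in_itv /= => xr; have Wx := Wd x xr.
  have H : is_derive x 1 E _ := is_deriveM (is_deriveM Wx Wx) (dexp x).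
  apply: is_derive_eq; rewrite mulrfctE /GRing.scale /= /E; ring.
have Ec : {within `[0, r], continuous E}.
  apply: continuous_subspaceT => x; apply: cvgM.
    by apply: cvgM; exact: Wc.
  exact: is_derive_continuous (dexp x).
have [c cr] := MVT r0 Ed Ec.
rewrite {2}/E W0 expr0n /= mul0r !subr0 => Er.
have Er0 : E r <= 0.
  have cr' : 0 < c < r by rewrite in_itv in cr.
  rewrite Er mulr_le0_ge0 ?(ltW r0)// mulr_le0_ge0//.
    by rewrite pmulr_rle0// subr_le0 aK.
  by rewrite mulr_ge0 ?sqr_ge0 ?expR_ge0.
have : W r ^+ 2 <= 0.
  by rewrite -(pmulr_lle0 _ (expR_gt0 (- (2 * K) * r))).
by rewrite real_exprn_even_le0 ?num_real//= => /eqP.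
Qed.

(** W = x^N (psi - phi) solves the regular linear equation W' = - x (psi +
    phi) W with W(0) = 0. *)
Lemma riccati_unique (R : realType) (N : nat) (sigma : R) (Q phi psi : R -> R) :
  (1 <= N)%N -> riccati_solution N sigma Q phi ->
  riccati_solution N sigma Q psi ->
  forall r : R, 0 <= r -> psi r = phi r.
Proof.
case: N => [//|n] _ [phiC phiE phi0] [psiC psiE psi0] r.
rewrite le_eqVlt => /predU1P[<-|r0]; first by rewrite phi0.
pose cphi (x : R) := phi (Num.max 0 x); pose cpsi (x : R) := psi (Num.max 0 x).
have cphic : continuous cphi by exact: C1_on_clamp_continuous.
have cpsic : continuous cpsi by exact: C1_on_clamp_continuous.
have C1d f (x : R) : C1_on `[0, +oo[ f -> 0 < x ->
    is_derive x 1 f (derive1 f x).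
  move=> [df [fd _]] x0.
  have fx : is_derive x 1 f (df x).
    apply/derivative_within_interior => //; apply: fd.
    by rewrite /= in_itv /= andbT ltW.
  by rewrite derive1E derive_val.
(* The factor x ^ N absorbs the singular term N / x of the equation for the
   difference. *)
pose W (x : R) := x ^+ n.+1 * (cpsi x - cphi x).
pose a (x : R) := - x * (cpsi x + cphi x).
have ac : continuous a.
  move=> x; apply: cvgM; first by apply: cvgN; exact: cvg_id.
  by apply: cvgD; [exact: cpsic|exact: cphic].
have Wc : continuous W.
  move=> x; apply: cvgM; first exact: exprn_continuous.
  by apply: cvgB; [exact: cpsic|exact: cphic].
have [c _ aK] := EVT_max (ltW r0) (continuous_subspaceT ac).
have Wd (x : R) : 0 < x < r -> is_derive x 1 W (a x * W x).
  move=> /andP[x0 _].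
  have dpsi := C1d _ _ psiC x0; have dphi := C1d _ _ phiC x0.
  have H : is_derive x 1 (fun y : R => y ^+ n.+1 * (psi y - phi y)) _ :=
    is_deriveM (is_derive_Xn n.+1 x) (is_deriveB dpsi dphi).
  apply: (@near_eq_is_derive _ _ _ (fun y : R => y ^+ n.+1 * (psi y - phi y))).
    near=> y; rewrite /W /cpsi /cphi.
    have y0 : 0 < y by near: y; exact: lt_nbhsr.
    by rewrite (max_idPr (ltW y0)).
  apply: is_derive_eq; rewrite opprfctE addrfctE /GRing.scale /= psiE// phiE//.
  rewrite /W /a /cpsi /cphi (max_idPr (ltW x0)) (exprS x n).
  have ? : x != 0 by rewrite gt_eqF.
  by move: (Q x / _) => w; field.
have : W r = 0.
  apply: (@linear_ode_eq0 R W a (a c) r) => //.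
    by rewrite /W expr0n /= mul0r.
  by move=> x /andP[/ltW x0 /ltW xr]; apply: aK; rewrite in_itv /= x0.
rewrite /W /cpsi /cphi (max_idPr (ltW r0)) => /eqP.
rewrite mulf_eq0 expf_eq0 /= gt_eqF//= subr_eq0 => /eqP.
Unshelve. all: by end_near.
Qed.

(** * Existence *)

Lemma limf_esup_lty_bounded (R : realType) (f : R -> R)
    (F : set_system R) {FF : Filter F} :
  (limf_esup (fun x => (f x)%:E) F < +oo)%E ->
  exists C, \forall x \near F, f x <= C.
Proof.
move=> /ereal_inf_lt [_ [V FV <-] supV].
exists (fine (ereal_sup [set (f x)%:E | x in V])).
apply: (@filterS _ F _ V _ _ FV) => x Vx.
have : ((f x)%:E <= ereal_sup [set (f x)%:E | x in V])%E.
  by apply: ereal_sup_ubound; exists x.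
by move: supV; case: (ereal_sup _) => //= y _; rewrite lee_fin.
Qed.

(** With w the radial mean of q u one has u' = r w and w' = q u / r - N w / r;
    the quotient rule for w / u then yields the quadratic term from u'. *)
Lemma is_derive_riccati (R : realType) (n : nat) (q u : R -> R) (r : R) :
  continuous q -> continuous u -> 0 < r -> u r != 0 ->
  (forall s : R, u s = 1 + volterra n (fun t => q t * u t) s) ->
  let phi (s : R) := radial_mean n (fun t => q t * u t) s / u s in
  is_derive r 1 phi
    (- r * phi r ^+ 2 - n.+1%:R / r * phi r + q r / r).
Proof.
move=> qc uc r0 ur0 uE phi.
have quc : continuous (fun t => q t * u t).
  by move=> x; apply: cvgM; [exact: qc|exact: uc].
have du : is_derive r 1 u (r * radial_mean n (fun t => q t * u t) r).
  have D : is_derive r 1 (fun s => 1 + volterra n (fun t => q t * u t) s) _ :=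
    is_deriveD (is_derive_cst (1 : R) r 1) (is_derive_volterra n quc r0).
  rewrite add0r in D; by rewrite [X in is_derive _ _ X _](funext uE).
have H : is_derive r 1 phi _ :=
  is_deriveM (is_derive_radial_mean n quc r0) (is_deriveV ur0 du).
apply: is_derive_eq; rewrite /GRing.scale /= /phi.
have ? : r != 0 by rewrite gt_eqF.
by field; apply/andP.
Qed.

(** Near 0 the function u is at most 2, so the averaged function q u is at
    most 2 C t^2; dividing by u, which is at least 1, can only decrease the
    mean. *)
Lemma radial_mean_quotient_quadratic (R : realType) (n : nat) (q u : R -> R)
    (C d : R) :
  continuous q -> continuous u -> (forall t, 0 <= q t) ->
  (forall t, 1 <= u t) -> u 0 = 1 -> 0 < d ->
  (forall t, 0 < t < d -> q t <= C * t ^+ 2) ->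
  exists2 d', 0 < d' & forall r, 0 < r < d' ->
    `|radial_mean n (fun t => q t * u t) r / u r| <= 2 * C * r ^+ 2.
Proof.
move=> qc uc q0 u1 u01 d0 qC.
have quc : continuous (fun t => q t * u t).
  by move=> x; apply: cvgM; [exact: qc|exact: uc].
have [e e0 eP] := (continuous_atP u 0).1 (uc 0) 1 ltr01.
exists (Num.min d e); first by rewrite lt_min d0.
move=> r /andP[r0]; rewrite lt_min => /andP[rd re].
have C0 : 0 <= C.
  have := le_trans (q0 r) (qC r _); rewrite r0 rd => /(_ isT).
  by rewrite pmulr_lge0// exprn_gt0.
have w : `|radial_mean n (fun t => q t * u t) r| <= 2 * C * r ^+ 2.
  apply: radial_mean_norm => // t /andP[t0 tr].
  have qt : q t <= C * t ^+ 2 by rewrite qC// t0 (lt_trans tr).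
  have ut : u t <= 2.
    have : `|u t - u 0| <= 1.
      by apply: eP; rewrite subr0 gtr0_norm// (lt_trans tr).
    by rewrite u01 ler_norml => /andP[_]; lra.
  have ut0 : 0 <= u t by rewrite (le_trans ler01).
  rewrite ger0_norm ?mulr_ge0// mulrC -mulrA; apply: ler_pM => //.
  apply: le_trans qt _; rewrite ler_wpM2l// ler_pXn2r ?nnegrE ?ltW//.
rewrite normrM normfV ler_pdivrMr ?normr_gt0 ?gt_eqF ?(lt_le_trans ltr01)//.
apply: le_trans w _; rewrite ler_peMr// ?mulr_ge0 ?exprn_ge0 ?(ltW r0)//.
by rewrite (le_trans (u1 r))// ler_norm.
Qed.

Lemma riccati_exists (R : realType) (N : nat) (sigma : R) (Q : R -> R) :
  (1 <= N)%N -> 0 < sigma -> {within `[0, +oo[, continuous Q} ->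
  (forall r, 0 <= r -> 0 <= Q r) ->
  (exists C, \forall r \near 0^'+, Q r / r ^+ 2 <= C) ->
  exists phi, riccati_solution N sigma Q phi.
Proof.
case: N => [//|n] _ s0 Qc Q0 [C nearC].
have s40 : 0 < sigma ^+ 4 by rewrite exprn_gt0.
pose q (r : R) := Q (Num.max 0 r) / sigma ^+ 4.
have qc : continuous q.
  move=> x; apply: cvgM; first exact: within_clamp_continuous Qc x.
  exact: cvg_cst.
have q0 r : 0 <= q r by rewrite divr_ge0 ?(ltW s40)// Q0// le_max lexx.
have qE r : 0 < r -> Q r / (sigma ^+ 4 * r) = q r / r.
  by move=> r0; rewrite /q (max_idPr (ltW r0)) invfM mulrA.
have [B B0 [d d0 dC]] : exists2 B, 0 <= B & exists2 d, 0 < d &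
    forall r, 0 < r < d -> q r <= B * r ^+ 2.
  exists (`|C| / sigma ^+ 4); first by rewrite divr_ge0// ltW.
  have [d /= d0 dP] := nearC; exists d => // r /andP[r0 rd].
  have := dP r; rewrite /= sub0r normrN gtr0_norm// => /(_ rd r0).
  rewrite ler_pdivrMr ?exprn_gt0// => QC.
  rewrite /q (max_idPr (ltW r0)) mulrAC ler_wpM2r ?invr_ge0 ?(ltW s40)//.
  by apply: le_trans QC _; rewrite ler_wpM2r ?exprn_ge0 ?ler_norm// ltW.
have [u uc uP] := volterra_fixpoint n qc q0.
have u1 r : 1 <= u r := (uP r).1; have uE r := (uP r).2.
have un0 r : u r != 0 by rewrite gt_eqF// (lt_le_trans ltr01).
have u01 : u 0 = 1.
  by rewrite uE /volterra (max_idPl (lexx 0)) primitive0 addr0.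
have [d' d'0 phiB] := radial_mean_quotient_quadratic n qc uc q0 u1 u01 d0 dC.
pose phi (r : R) := radial_mean n (fun t => q t * u t) r / u r.
pose dphi (r : R) := - r * phi r ^+ 2 - n.+1%:R / r * phi r
                     + Q r / (sigma ^+ 4 * r).
have phi0 : phi 0 = 0 by rewrite /phi /radial_mean primitive0 !mul0r.
have phid (r : R) : 0 < r -> is_derive r 1 phi (dphi r).
  move=> r0; rewrite /dphi qE//.
  exact: is_derive_riccati.
exists phi; split => //; last first.
  by move=> r r0; rewrite derive1E; have [_ ->] := phid r r0.
pose K := 2 * B + (2 * B) ^+ 2 + n.+1%:R * (2 * B) + B.
(* The extra bound 1 lets the r ^+ 5 coming from r * phi ^+ 2 be dominated by r;
   K adds up one constant per term of the equation. *)
apply: (@C1_on_quadratic_origin R phi dphi K (Num.min (Num.min d d') 1)) => //.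
- by rewrite !lt_min d0 d'0 /=.
- by rewrite /dphi phi0 oppr0 mul0r mulr0 subr0 mulr0 invr0 mulr0 addr0.
- move=> r r0; rewrite /dphi.
  have mr : Num.max 0 r = r by apply/max_idPr/ltW.
  have mc : (Num.max 0 s @[s --> r] --> Num.max 0 r)%R.
    exact: (@clamp_continuous R r).
  have pc : phi (Num.max 0 s) @[s --> r] --> phi (Num.max 0 r).
    apply: (@continuous_comp _ _ _ (Num.max (0 : R)) phi r) => //.
    by rewrite mr; exact: is_derive_continuous (phid r r0).
  apply: cvgD; first apply: cvgB.
  + by apply: cvgM; [exact: cvgN|rewrite !expr2; exact: cvgM].
  + apply: cvgM => //; apply: cvgM; first exact: cvg_cst.
    by apply: cvgV => //; rewrite mr gt_eqF.
  + apply: cvgM; first exact: within_clamp_continuous Qc r.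
    apply: cvgV; first by rewrite mr mulf_neq0 ?gt_eqF.
    by apply: cvgM => //; exact: cvg_cst.
- move=> r /andP[r0]; rewrite !lt_min => /andP[/andP[rd rd'] r1].
  apply: le_trans (phiB r _) _; first by rewrite r0.
  rewrite ler_wpM2r ?exprn_ge0 ?(ltW r0)// /K.
  by rewrite -!addrA lerDl addr_ge0 ?sqr_ge0// addr_ge0// mulr_ge0// mulr_ge0.
- move=> r /andP[r0]; rewrite !lt_min => /andP[/andP[rd rd'] r1].
  have pB : `|phi r| <= 2 * B * r ^+ 2 by apply: phiB; rewrite r0.
  have qB : q r <= B * r ^+ 2 by apply: dC; rewrite r0.
  have t1 : `|- r * phi r ^+ 2| <= (2 * B) ^+ 2 * r.
    rewrite normrM normrN (gtr0_norm r0) mulrC ler_wpM2r ?(ltW r0)//.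
    rewrite normrX ler_pXn2r ?nnegrE ?mulr_ge0//.
    apply: le_trans pB _; rewrite ler_piMr//; first exact: mulr_ge0.
    by rewrite exprn_ile1// ltW.
  have t2 : `|n.+1%:R / r * phi r| <= n.+1%:R * (2 * B) * r.
    rewrite normrM ger0_norm ?divr_ge0 ?(ltW r0)//.
    have -> : n.+1%:R * (2 * B) * r = n.+1%:R / r * (2 * B * r ^+ 2).
      by have ? : r != 0; [rewrite gt_eqF|field].
    by rewrite ler_wpM2l// divr_ge0 ?(ltW r0).
  have t3 : `|q r / r| <= B * r.
    have qr0 : 0 <= q r / r := divr_ge0 (q0 r) (ltW r0).
    by rewrite (ger0_norm qr0) (ler_pdivrMr _ _ r0) -mulrA -expr2.
  rewrite /dphi qE//.
  apply: le_trans (ler_normD _ _) (le_trans (lerD (ler_normB _ _) t3) _).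
  apply: le_trans (lerD (lerD t1 t2) (lexx _)) _.
  rewrite -2!mulrDl ler_wpM2r ?(ltW r0)// /K.
  by rewrite -!addrA lerDr mulr_ge0.
Qed.

Theorem theorem8p1 (R : realType) (N : nat) (sigma : R) (Q : R -> R)
    (hN : (1 <= N)%N) (hsigma : 0 < sigma)
    (hQc : {within `[0, +oo[, continuous Q})
    (hQ0 : forall r : R, 0 <= r -> 0 <= Q r)
    (hQlim : (limf_esup (fun r : R => (Q r / r ^+ 2)%:E) 0^'+ < +oo)%E) :
  exists phi : R -> R,
    riccati_solution N sigma Q phi /\
    forall psi : R -> R, riccati_solution N sigma Q psi ->
      forall r : R, 0 <= r -> psi r = phi r.
Proof.
have Qb := limf_esup_lty_bounded
  (FF := at_right_proper_filter 0) hQlim.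
have [phi phiP] := riccati_exists hN hsigma hQc hQ0 Qb.
by exists phi; split=> // psi; exact: riccati_unique.
Qed.
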